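(* Let $k\ge 3$, $2\le n\le k$, and let $f\in P_k^n$ depend essentially on all of its $n$ variables. Then $f\in G_{n,k}^n$ if and only if there are constants $a_0\in K$ and $a_{\beta}\in K$ (one for each string $\beta=\beta_1\ldots\beta_n\in K^n\setminus Eq_k^n$) such that $$f=\Big[\bigoplus_{\beta_1\ldots\beta_n\notin Eq_k^n} a_{\beta}\,x_1^{\beta_1}\cdots x_n^{\beta_n}\Big]\oplus a_0\Big[\bigoplus_{\alpha_1\ldots\alpha_n\in Eq_k^n}x_1^{\alpha_1}\cdots x_n^{\alpha_n}\Big],$$ and at least two among the coefficients in $\{a_0\}\cup\{a_\beta:\beta\in K^n\setminus Eq_k^n\}$ are distinct.
   Context: $K=\{0,1,\ldots,k-1\}$ is the ring of residues modulo $k$, with $\oplus$ and juxtaposition/$\cdot$ denoting addition and multiplication modulo $k$. $P_k^n$ is the set of all functions $K^n\to K$ in variables $x_1,\ldots,x_n$. For a variable $x$ and $\alpha\in K$, $x^\alpha=1$ if $x=\alpha$ and $0$ otherwise. A variable $x_i$ is essential in $f$ if changing only the $i$-th argument can change the value of $f$; $Ess(f)$ is the set of essential variables, $ess(f)=|Ess(f)|$. For $i\neq j$, $f_{i\leftarrow j}(a_1,\ldots,a_n)=f(a_1,\ldots,a_{i-1},a_j,a_{i+1},\ldots,a_n)$. $Min(f)$ is the set of all $f_{i\leftarrow j}$ with $i\neq j$ and $x_i,x_j\in Ess(f)$; $gap(f)=ess(f)-\max_{g\in Min(f)}ess(g)$. $G_{p,k}^m=\{f\in P_k^n: ess(f)=m,\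 gap(f)=p\}$. $Eq_k^n$ is the set of strings $\alpha_1\ldots\alpha_n\in K^n$ with $\alpha_i=\alpha_j$ for some $i\neq j$. *)

(* Defs.v *)
From mathcomp Require Export all_boot all_algebra.

Set Implicit Arguments.
Unset Strict Implicit.
Unset Printing Implicit Defensive.

Import GRing.Theory.
Local Open Scope ring_scope.

(* 'Z_k is the ring of residues modulo k as soon as 1 < k. The variable x_i
   is represented by its index i : 'I_n, counted from 0. *)
Notation point k n := {ffun 'I_n -> 'Z_k}.
Notation Pfun k n := {ffun point k n -> 'Z_k}.

Section KValuedFunctions.
Variables k n : nat.
Implicit Types (f g : Pfun k n) (a x : point k n).

Definition upd a (i : 'I_n) (c : 'Z_k) : point k n :=
  [ffun l => if l == i then c else a l].

Definition essential f (i : 'I_n) : bool :=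
  [exists a : point k n, exists c : 'Z_k, f (upd a i c) != f a].

Definition Ess f : {set 'I_n} := [set i | essential f i].

Definition ess f : nat := #|Ess f|.

Definition identify f (i j : 'I_n) : Pfun k n :=
  [ffun a : point k n => f (upd a i (a j))].

Definition Min f : {set Pfun k n} :=
  [set g | [exists i, exists j,
     [&& i != j, i \in Ess f, j \in Ess f & g == identify f i j]]].

(* Subtraction on nat loses nothing: a minor of f has fewer essential variables
   than f. If Min f is empty (that is, if ess f < 2), the maximum is 0. *)
Definition gap f : nat := (ess f - \max_(g in Min f) ess g)%N.

Definition Gset (p m : nat) : {set Pfun k n} :=
  [set f | (ess f == m) && (gap f == p)].

Definition Eqs : {set point k n} :=
  [set a : point k n | [exists i, exists j, (i != j) && (a i == a j)]].

(* x^b in the notation of many-valued logic, not a power in the ring *)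
Definition chi (x b : 'Z_k) : 'Z_k := if x == b then 1 else 0.

Definition monom (b x : point k n) : 'Z_k := \prod_(i < n) chi (x i) (b i).

End KValuedFunctions.

Arguments Gset k n p m : clear implicits.
Arguments Eqs k n : clear implicits.

(* Main.v *)
(** A tuple has a repeated coordinate exactly when it lies in the image of some
    identification [x_i := x_j], so [gap f = n] (all minors have no essential
    variable, i.e. are constant) means that [f] is constant on each set
    [x_i = x_j]. These sets all contain the diagonal, hence the constants agree,
    and the claim is that [f] is constant on [Eqs k n]. *)
Require Import Defs.
From mathcomp Require Import all_boot all_algebra.

Import GRing.Theory.
Local Open Scope ring_scope.

Section ConstantOnEqs.
Variables k n : nat.
Implicit Types (f : Pfun k n) (a b x y : point k n).

(** A single mismatched coordinate puts a zero factor into the product. *)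
Lemma monomE b x : monom b x = (x == b)%:R.
Proof.
rewrite /monom; case: (eqVneq x b) => [->|neq_xb].
  by rewrite big1 // => i _; rewrite /chi eqxx.
have /forallPn[i neq_i] : ~~ [forall i, x i == b i].
  by apply: contraNN neq_xb => /forallP eq_xb; apply/eqP/ffunP=> i; apply/eqP.
by rewrite (bigD1 i) //= /chi (negPf neq_i) mul0r.
Qed.

Lemma sum_monom (P : pred (point k n)) (c : point k n -> 'Z_k) x :
  \sum_(b | P b) c b * monom b x = if P x then c x else 0.
Proof.
rewrite big_mkcond (bigD1 x) //= monomE eqxx mulr1.
rewrite [X in _ + X]big1 ?addr0 // => b neq_bx.
by rewrite monomE eq_sym (negPf neq_bx) mulr0 if_same.
Qed.

(** Only the monomial with [b = x] survives at [x], so the coefficients of the form are simply its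
    values. *)
Lemma canonical_formE (a0 : 'Z_k) (c : point k n -> 'Z_k) x :
  (\sum_(b | b \notin Eqs k n) c b * monom b x)
    + a0 * (\sum_(b in Eqs k n) monom b x)
  = if x \in Eqs k n then a0 else c x.
Proof.
rewrite mulr_sumr (sum_monom (fun b => b \notin Eqs k n)).
rewrite (sum_monom (mem (Eqs k n)) (fun=> a0)) /=.
by case: (x \in Eqs k n); rewrite /= ?add0r ?addr0.
Qed.

Lemma EqsP x :
  reflect (exists i j, i != j /\ x i = x j) (x \in Eqs k n).
Proof.
rewrite inE; apply: (iffP existsP) => [[i /existsP[j /andP[ij /eqP xij]]]|].
  by exists i, j.
by case=> i [j [ij xij]]; exists i; apply/existsP; exists j; rewrite ij xij eqxx.
Qed.

Lemma upd_id x i : upd x i (x i) = x.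
Proof. by apply/ffunP=> l; rewrite ffunE; case: eqP => [->|]. Qed.

Lemma upd_Eqs x i j : i != j -> upd x i (x j) \in Eqs k n.
Proof.
by move=> ij; apply/EqsP; exists i, j; rewrite !ffunE eqxx [j == i]eq_sym (negPf ij).
Qed.

Lemma inessential_upd f i x c : i \notin Ess f -> f (upd x i c) = f x.
Proof.
rewrite inE; apply: contraNeq => neq_f.
by apply/existsP; exists x; apply/existsP; exists c.
Qed.

Lemma ess_const f (c : 'Z_k) : (forall x, f x = c) -> ess f = 0%N.
Proof.
move=> f_c; apply/eqP; rewrite cards_eq0 -subset0; apply/subsetP=> i.
by rewrite inE => /existsP[x /existsP[d]]; rewrite !f_c eqxx.
Qed.

Lemma ess_eq0_const f x y : ess f = 0%N -> f x = f y.
Proof.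
move=> /eqP; rewrite cards_eq0 => /eqP Ess0.
(* replace the coordinates of [x] by those of [y] one after the other *)
pose mix (m : nat) : point k n := [ffun l : 'I_n => if (l < m)%N then y l else x l].
have mix_x m : (m <= n)%N -> f (mix m) = f x.
  elim: m => [_|m IHm lt_mn].
    by congr (f _); apply/ffunP=> l; rewrite ffunE.
  rewrite -(IHm (ltnW lt_mn)).
  (* [mix m.+1] is [mix m] updated at the inessential coordinate [m]. *)
  rewrite -(@inessential_upd f (Ordinal lt_mn) (mix m) (y (Ordinal lt_mn)));
    last by rewrite Ess0 inE.
  congr (f _); apply/ffunP=> l; rewrite !ffunE ltnS leq_eqVlt -val_eqE /=.
  by case: eqP => //= eq_lm; congr (y _); apply: val_inj.
rewrite -(mix_x n (leqnn n)); congr (f _); apply/ffunP=> l.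
by rewrite ffunE ltn_ord.
Qed.

Lemma Min_identify f i j :
  Ess f = [set: 'I_n] -> i != j -> identify f i j \in Min f.
Proof.
move=> hf ij; rewrite inE; apply/existsP; exists i; apply/existsP; exists j.
by rewrite ij hf !inE eqxx.
Qed.

Lemma Gset_full f : (0 < n)%N -> Ess f = [set: 'I_n] ->
  f \in Gset k n n n <-> (forall g, g \in Min f -> ess g = 0%N).
Proof.
move=> n_gt0 hf; have ess_f : ess f = n by rewrite /ess hf cardsT card_ord.
rewrite inE /gap ess_f eqxx /=; split=> [/eqP gap_f g Mg | Min0].
  have max0 : \max_(h in Min f) ess h = 0%N.
    (* Subtracting a positive maximum from [n > 0] would give less than [n]. *)
    apply/eqP; rewrite eqn0Ngt; apply/negP=> max_gt0.
    have := ltn_subrL (\max_(h in Min f) ess h) n.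
    by rewrite gap_f ltnn n_gt0 max_gt0.
  by apply/eqP; rewrite -leqn0 -max0; apply: leq_bigmax_cond.
by rewrite big1 ?subn0.
Qed.

Lemma Gset_const_Eqs f : (0 < n)%N -> Ess f = [set: 'I_n] ->
  f \in Gset k n n n <-> exists a0 : 'Z_k, {in Eqs k n, forall x, f x = a0}.
Proof.
move=> n_gt0 hf; apply: (iff_trans (Gset_full _ n_gt0 hf)).
split=> [Min0 | [a0 f_a0] g].
  (* A diagonal point is fixed by every identification, so all minors take the value [f o] there. *)
  pose o : point k n := [ffun=> 0].
  exists (f o) => x /EqsP[i [j [ij xij]]].
  have := ess_eq0_const _ x o (Min0 _ (Min_identify _ _ _ hf ij)).
  have o_ji : o j = o i by rewrite !ffunE.
  (* As [x i = x j], the identification fixes [x] too: the minor agrees with [f] at both points. *)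
  by rewrite [LHS]ffunE [RHS]ffunE -xij o_ji !upd_id.
rewrite inE => /existsP[i /existsP[j /and4P[ij _ _ /eqP->]]].
by apply: (ess_const _ a0) => x; rewrite ffunE f_a0 // upd_Eqs.
Qed.

End ConstantOnEqs.

Theorem theorem3p2 (k n : nat) (hk : (3 <= k)%N) (hn : (2 <= n <= k)%N)
    (f : Pfun k n) (hf : Ess f = [set: 'I_n]) :
  f \in Gset k n n n <->
  exists (a0 : 'Z_k) (a : point k n -> 'Z_k),
    f = [ffun x : point k n =>
           (\sum_(b | b \notin Eqs k n) a b * monom b x)
           + a0 * (\sum_(b in Eqs k n) monom b x)]
    /\ (exists c d : 'Z_k,
          [/\ c \in a0 |: [set a b | b in ~: Eqs k n],
              d \in a0 |: [set a b | b in ~: Eqs k n] & c <> d]).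
Proof.
have n_gt0 : (0 < n)%N by case/andP: hn => /ltnW.
apply: (iff_trans (Gset_const_Eqs _ _ _ n_gt0 hf)).
split=> [[a0 f_a0] | [a0 [a [-> _]]]].
  (* The function [f] serves as its own coefficient family. *)
  exists a0, f; split.
    by apply/ffunP=> x; rewrite ffunE canonical_formE; case: ifP => // /f_a0.
  (* An essential variable yields two distinct values of [f]; every value is a coefficient, namely
     [a0] on [Eqs k n] and [f y] off it. *)
  pose i0 := Ordinal n_gt0.
  have : i0 \in Ess f by rewrite hf inE.
  rewrite inE => /existsP[x /existsP[c /eqP neq_f]].
  have f_coef y : f y \in a0 |: [set f b | b in ~: Eqs k n].
    rewrite in_setU1; case: (boolP (y \in Eqs k n)) => [/f_a0->|yNE].
      by rewrite eqxx.
    by rewrite imset_f ?orbT // inE.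
  by exists (f (upd x i0 c)), (f x); split.
by exists a0 => x xE; rewrite ffunE canonical_formE xE.
Qed.
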